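(* For every integer $d\geq 2$, no (randomized) online algorithm for online bipartite matching on $d$-regular bipartite graphs achieves a competitive ratio larger than $$\eta(d)=1-\sum_{i=\lceil d/2\rceil+1}^{d}\left(\frac{i-\lceil d/2\rceil}{d}\binom{d}{i}\left(\frac{\lfloor d/2\rfloor}{d}\right)^{d-i}\left(1-\frac{\lfloor d/2\rfloor}{d}\right)^{i}\right).$$
   Context: Online bipartite matching: a bipartite graph $G=(S\cup R,E)$ has offline servers $S$ and online requests $R$ arriving one at a time in adversarial order; on arrival of $r$ its neighbors are revealed and the algorithm irrevocably matches $r$ to an unmatched neighbor or leaves it unmatched. The competitive ratio of an algorithm on a class of instances is the infimum over instances of $\mathbb{E}[\mathsf{ALG}]/\mathsf{OPT}$, where $\mathsf{ALG}$ is the size of the produced matching and $\mathsf{OPT}$ the maximum matching size. A bipartite graph is $d$-regular if every vertex has degree exactly $d$. *)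

(* Defs.v *)
From HB Require Import structures.
From mathcomp Require Import all_boot all_order all_algebra.
From mathcomp Require Import all_classical all_reals all_analysis.

Set Implicit Arguments.
Unset Strict Implicit.
Unset Printing Implicit Defensive.

Import Order.TTheory GRing.Theory Num.Theory.
Local Open Scope ring_scope.

(** An instance is a simple bipartite graph together with an arrival order of
    its requests: requests are named by their arrival time, so that request [r]
    is the one that arrives after exactly [r] others.  Quantifying over all
    instances therefore quantifies over all graphs and all arrival orders. *)
Record instance := Instance {
  nservers : nat;
  nrequests : nat;
  edge : 'I_nservers -> 'I_nrequests -> bool }.

Notation server G := 'I_(nservers G).
Notation request G := 'I_(nrequests G).

Definition neighbors (G : instance) (r : request G) : {set server G} :=
  [set s | edge s r].

Definition d_regular (d : nat) (G : instance) : Prop :=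
  (forall s : server G, #|[set r : request G | edge s r]| = d) /\
  (forall r : request G, #|neighbors r| = d).

Definition is_matching (G : instance) (M : {set server G * request G}) : bool :=
  [forall p in M, edge p.1 p.2] &&
  [forall p in M, forall q in M,
     ((p.1 == q.1) || (p.2 == q.2)) ==> (p == q)].

Definition OPT (G : instance) : nat :=
  \max_(M : {set server G * request G} | is_matching M) #|M|.

(** A deterministic online strategy.  The number [n] of offline servers is known
    in advance.  When a request arrives, the strategy is given the neighborhoods
    revealed so far, in arrival order, that of the current request being the
    last one; it answers with a server to match, or [None] to leave the request
    unmatched.  Its own past answers are determined by the prefixes of the same
    sequence, hence need not be passed as an argument. *)
Definition strategy := forall n : nat, seq {set 'I_n} -> option 'I_n.

Definition revealed (G : instance) (r : request G) : seq {set server G} :=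
  [seq neighbors r' | r' : request G <- enum 'I_(nrequests G) & (r' <= r)%N].

Definition output (f : strategy) (G : instance) : {set server G * request G} :=
  [set p | f _ (revealed p.2) == Some p.1].

Section Randomized.
Context {disp : measure_display} {T : measurableType disp} {R : realType}.

(** A randomized strategy is a strategy [A w] depending on a random seed [w]
    drawn from an arbitrary probability space.  On every [d]-regular instance and
    for every seed, each request must be left unmatched or matched to one of its
    neighbors that is still free, that is, the produced set of pairs must be a
    matching. *)
Definition online_algorithm (d : nat) (A : T -> strategy) : Prop :=
  (forall (n : nat) (h : seq {set 'I_n}) (o : option 'I_n),
     measurable [set w : T | A w n h = o]%classic) /\
  (forall (w : T) (G : instance), d_regular d G -> is_matching (output (A w) G)).

Definition ALG (A : T -> strategy) (G : instance) (w : T) : R :=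
  #|output (A w) G|%:R.

(** Instances without edges, where the ratio would be 0/0, are excluded. *)
Definition competitive_ratio (P : probability T R) (d : nat) (A : T -> strategy)
    : \bar R :=
  ereal_inf [set ('E_P[ALG A G] / (OPT G)%:R%:E)%E
            | G in [set G : instance | d_regular d G /\ (0 < OPT G)%N]]%classic.

End Randomized.

(** [uphalf d] is the ceiling of d/2 and [d./2] its floor. *)
Definition eta (R : realType) (d : nat) : R :=
  1 - \sum_((uphalf d).+1 <= i < d.+1)
        ((i - uphalf d)%:R / d%:R * 'C(d, i)%:R
         * ((d./2)%:R / d%:R) ^+ (d - i) * (1 - (d./2)%:R / d%:R) ^+ i).

(* Main.v *)
Require Import Defs.
From mathcomp Require Import all_boot all_order all_algebra.
From mathcomp Require Import all_classical all_reals all_analysis.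
From mathcomp Require Import measurable_realfun.
From mathcomp Require Import zify ring.

(** Yao's principle, with an exactly solvable random instance.  Put
    [c = uphalf d] and arrange d^2 servers in d blocks of size d.  First every
    block receives c requests adjacent to the whole block.  Then a uniformly
    random cyclic shift is applied in each block independently, the shifted
    blocks are cut into d transversals ("groups"), and every group receives
    d - c requests adjacent to the whole group.  If the algorithm matched all
    the early requests, then each block has exactly c matched servers, so the
    number X of servers of a group that are already matched is exactly
    Bin(d, c/d), and max(X - c, 0) of the requests of that group are lost.
    Leaving early requests unmatched does not help, whereas the instance has
    a perfect matching. *)

Set Implicit Arguments.
Unset Strict Implicit.
Unset Printing Implicit Defensive.

Import Order.TTheory GRing.Theory Num.Theory.
Local Open Scope ring_scope.

(** * Counting: subsets, ordinals and binomial sums *)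

Lemma subset_of_card (T : finType) (A : {set T}) (c : nat) :
  (#|A| <= c <= #|T|)%N -> exists2 B : {set T}, A \subset B & #|B| = c.
Proof.
case/andP=> Ac cT.
pose s := take (c - #|A|) (enum (~: A)).
have szs : size s = (c - #|A|)%N.
  rewrite size_takel // -cardE; have := cardsC A; lia.
have us : uniq s by rewrite take_uniq ?enum_uniq.
exists (A :|: [set x in s]); first exact: finset.subsetUl.
rewrite cardsU (_ : A :&: _ = finset.set0).
  by rewrite cards0 subn0 cardsE (card_uniqP us) szs subnKC.
apply/setP=> x; rewrite !inE; apply/negP => /andP[xA /mem_take].
by rewrite mem_enum inE xA.
Qed.

Lemma card_ord_ltn (m c : nat) :
  (c <= m)%N -> #|[set q : 'I_m | (q < c)%N]| = c.
Proof.
move=> cm; have inj : injective (widen_ord cm).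
  by move=> x y /(congr1 val) /= xy; apply: val_inj.
rewrite -[RHS]card_ord -(card_imset predT inj).
apply: eq_card => q; rewrite inE; apply/idP/imsetP => [qc|[x _ ->] /=].
  by exists (Ordinal qc) => //; apply: val_inj.
exact: ltn_ord.
Qed.

Lemma card_ord_geq (m c : nat) :
  (c <= m)%N -> #|[set q : 'I_m | ~~ (q < c)%N]| = (m - c)%N.
Proof.
move=> cm; have := cardsC [set q : 'I_m | (q < c)%N].
rewrite card_ord card_ord_ltn //.
rewrite (_ : ~: _ = [set q : 'I_m | ~~ (q < c)%N]); first lia.
by apply/setP => q; rewrite !inE.
Qed.

Lemma card_ffun_hits (I T : finType) (c : nat) (W : I -> {set T}) (J : {set I}) :
  (forall i, #|W i| = c) ->
  #|[set s : {ffun I -> T} | [set i | s i \in W i] == J]| =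
  (c ^ #|J| * (#|T| - c) ^ (#|I| - #|J|))%N.
Proof.
move=> cW.
rewrite (_ : #|_| = #|family (fun i => if i \in J then mem (W i)
                                       else mem (~: W i))|); last first.
  apply: eq_card => s; rewrite inE; apply/eqP/familyP => [<- i|sJ].
    by rewrite inE; case: ifP => //; rewrite inE => ->.
  by apply/setP => i; rewrite inE; have := sJ i; case: ifP => // _; rewrite inE => /negbTE.
rewrite card_family foldrE big_map big_enum /= (bigID (mem J)) /=.
rewrite (eq_bigr (fun=> c)); last by move=> i ->; rewrite -(cW i).
rewrite [X in (_ * X)%N](eq_bigr (fun=> #|T| - c)%N); last first.
  by move=> i /negbTE->; rewrite -(cW i) -(cardsC (W i)) addKn.
rewrite !prod_nat_const; congr (_ * _ ^ _)%N.
by rewrite -(cardC J) addKn; apply: eq_card => i.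
Qed.

(** Unnormalised expectation of [g X] with [X] binomial: for uniform [s] the events [s i \in W i]
    are independent, each of probability c/#|T|. *)
Lemma sum_ffun_hits (I T : finType) (c : nat) (W : I -> {set T}) (g : nat -> nat) :
  (forall i, #|W i| = c) ->
  (\sum_(s : {ffun I -> T}) g #|[set i | s i \in W i]| =
   \sum_(k < #|I|.+1) g k * ('C(#|I|, k) * (c ^ k * (#|T| - c) ^ (#|I| - k))))%N.
Proof.
move=> cW.
rewrite (partition_big (fun s : {ffun I -> T} => [set i | s i \in W i]) predT) //=.
rewrite (eq_bigr (fun J : {set I} => g #|J| * (c ^ #|J| * (#|T| - c) ^ (#|I| - #|J|)))%N).
  rewrite (partition_big (fun J : {set I} => inord #|J| : 'I_#|I|.+1) predT) //=.
  apply: eq_bigr => k _.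
  have eqk (J : {set I}) : (inord #|J| == k) = (#|J| == k).
    by rewrite -val_eqE /= inordK // ltnS max_card.
  rewrite (eq_bigl _ _ eqk).
  rewrite (eq_bigr (fun=> g k * (c ^ k * (#|T| - c) ^ (#|I| - k)))%N); last first.
    by move=> J /eqP->.
  by rewrite sum_nat_const -card_draws cardsE mulnCA.
move=> J _; rewrite -(card_ffun_hits J cW).
rewrite (eq_bigr (fun=> g #|J|)); last by move=> s /eqP->.
by rewrite sum_nat_const cardsE mulnC.
Qed.

(** * Matchings *)

Lemma matching_edge (G : instance) (M : {set server G * request G}) v r :
  is_matching M -> (v, r) \in M -> edge v r.
Proof. by case/andP=> /forall_inP/(_ (v, r)) H _ /H. Qed.

Lemma matching_inj1 (G : instance) (M : {set server G * request G}) :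
  is_matching M -> {in M &, injective fst}.
Proof.
case/andP=> _ /forall_inP H p q pM qM pq; have /forall_inP/(_ q qM) := H p pM.
by rewrite pq eqxx => /eqP.
Qed.

Lemma matching_inj2 (G : instance) (M : {set server G * request G}) :
  is_matching M -> {in M &, injective snd}.
Proof.
case/andP=> _ /forall_inP H p q pM qM pq; have /forall_inP/(_ q qM) := H p pM.
by rewrite pq eqxx orbT => /eqP.
Qed.

Lemma OPT_le_nservers (G : instance) : (OPT G <= nservers G)%N.
Proof.
apply/bigmax_leqP => M /matching_inj1 /card_in_imset <-.
by rewrite -[leqRHS]card_ord max_card.
Qed.

(** * The hard instances: regularity and perfect matchings *)

Section HardInstance.
Variables n c : nat.
Local Notation d := n.+1.

(** Base-[d] digits: block and position of a server, round and index of a request. With [d = n.+1],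
    ['I_d] is the group of integers modulo [d]. *)
Definition hi (r : 'I_(d * d)) : 'I_d := inord (r %/ d).
Definition lo (r : 'I_(d * d)) : 'I_d := inord (r %% d).

Fact slot_subproof (a b : 'I_d) : (a * d + b < d * d)%N.
Proof. by have := ltn_ord a; have := ltn_ord b; nia. Qed.

Definition slot (a b : 'I_d) : 'I_(d * d) := Ordinal (slot_subproof a b).

Lemma hiE (r : 'I_(d * d)) : hi r = (r %/ d)%N :> nat.
Proof. by rewrite inordK // ltn_divLR. Qed.

Lemma loE (r : 'I_(d * d)) : lo r = (r %% d)%N :> nat.
Proof. by rewrite inordK // ltn_pmod. Qed.

Lemma hi_slot a b : hi (slot a b) = a.
Proof. by apply: val_inj; rewrite /= hiE divnMDl // divn_small ?addn0. Qed.

Lemma lo_slot a b : lo (slot a b) = b.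
Proof. by apply: val_inj; rewrite /= loE modnMDl modn_small. Qed.

Lemma slot_hi_lo r : slot (hi r) (lo r) = r.
Proof. by apply: val_inj; rewrite /= hiE loE -divn_eq. Qed.

Lemma hi_lo_inj r r' : hi r = hi r' -> lo r = lo r' -> r = r'.
Proof. by move=> h l; rewrite -(slot_hi_lo r) h l slot_hi_lo. Qed.

Lemma hi_homo (r r' : 'I_(d * d)) : (r' <= r)%N -> (hi r' <= hi r)%N.
Proof. by rewrite !hiE; apply: leq_div2r. Qed.

(* Server [slot j x] is the [x]-th server of block [j].  Request [slot q b]
   comes in round [q]: if [q < c] it sees block [b], otherwise it sees group
   [b], which consists of the server [slot j (s j + b)] of every block [j]
   (addition modulo [d]). *)
Definition hard (s : {ffun 'I_d -> 'I_d}) : instance :=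
  @Instance (d * d) (d * d) (fun v r =>
    if (hi r < c)%N then hi v == lo r else lo v == s (hi v) + lo r).

Lemma hard_regular s : d_regular d (hard s).
Proof.
split=> [v|r] /=.
  (* In each round a server sees exactly one request, that of its block or that of its group
     [lo v - s (hi v)]. *)
  pose req (q : 'I_d) := slot q (if (q < c)%N then hi v else lo v - s (hi v)).
  have inj : injective req by move=> q q' /(congr1 hi); rewrite !hi_slot.
  rewrite -[RHS]card_ord -(card_imset predT inj); apply: eq_card => r.
  rewrite inE; apply/idP/imsetP => /= [e|[q _ ->]].
    exists (hi r) => //; apply: hi_lo_inj; rewrite ?hi_slot ?lo_slot //.
    case: ifP e => _ /eqP -> //; first by rewrite addrC addKr.
  by rewrite hi_slot lo_slot; case: (q < c)%N; rewrite ?subrKC.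
pose srv (x : 'I_d) := if (hi r < c)%N then slot (lo r) x else slot x (s x + lo r).
have inj : injective srv.
  rewrite /srv => x x'; case: ifP => _; first by move/(congr1 lo); rewrite !lo_slot.
  by move/(congr1 hi); rewrite !hi_slot.
rewrite -[RHS]card_ord -(card_imset predT inj); apply: eq_card => v.
rewrite inE /= /srv; apply/idP/imsetP => /= [|[x _ ->]].
  case: ifP => _ /eqP e; [exists (lo v) | exists (hi v)] => //.
    by rewrite -e slot_hi_lo.
  by rewrite -e slot_hi_lo.
by case: (hi r < c)%N; rewrite ?hi_slot ?lo_slot.
Qed.

Lemma OPT_hard s : OPT (hard s) = (d * d)%N.
Proof.
apply/eqP; rewrite eqn_leq OPT_le_nservers /=.
(* [v] lies in group [k v]; the rounds [k v + hi v] (modulo [d]) run through all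
   of ['I_d] both within a block and within a group *)
pose k (v : 'I_(d * d)) : 'I_d := lo v - s (hi v).
pose req v := slot (k v + hi v) (if ((k v + hi v)%R < c)%N then hi v else k v).
have req_inj : injective req.
  move=> v v'; rewrite /req => e.
  (* Equal requests share their round, so both servers fall into the same case of [req]. *)
  have e1 : k v + hi v = k v' + hi v' by move/(congr1 hi): e; rewrite !hi_slot.
  move/(congr1 lo): e; rewrite !lo_slot e1; case: ifP => _ e.
    apply: hi_lo_inj => //; move: e1; rewrite /k e => /addIr /addIr; exact.
  move: e1; rewrite e => /addrI e1.
  by apply: hi_lo_inj => //; move: e; rewrite /k e1 => /addIr.
pose M : {set server (hard s) * request (hard s)} := [set p | p.2 == req p.1].
have Mm : is_matching M.
  apply/andP; split; apply/forall_inP => -[v r]; rewrite inE /= => /eqP ->.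
    by rewrite hi_slot lo_slot; case: (_ < c)%N; rewrite /k ?subrKC.
  apply/forall_inP => -[v' r']; rewrite inE /= => /eqP ->.
  by apply/implyP => /orP[/eqP->//|/eqP /req_inj ->].
rewrite (leq_trans _ (leq_bigmax_cond _ Mm)) //.
have inj : injective (fun v => (v, req v)) by move=> v v' [].
rewrite -[X in (X <= _)%N](card_ord (d * d)) -(card_imset predT inj).
apply: subset_leq_card; apply/fintype.subsetP => p /imsetP[v _ ->].
by rewrite inE /=.
Qed.

(** * Loss of a deterministic strategy *)

(** The shifts affect only rounds from [c] on, so the early answers of a strategy cannot depend on
    them. *)
Lemma revealed_hard (s s' : {ffun 'I_d -> 'I_d}) (r : 'I_(d * d)) : (hi r < c)%N ->
  revealed (G := hard s) r = revealed (G := hard s') r.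
Proof.
move=> rc; rewrite /revealed; apply/eq_in_map => r'.
rewrite mem_filter => /andP[/hi_homo r'r _]; apply/setP => v; rewrite !inE /=.
by rewrite (leq_ltn_trans r'r rc).
Qed.

(* [W j] extends the set of servers of block [j] that are matched in the first
   [c] rounds to exactly [c] servers: a server added to [W j] can gain at most
   one unit later, which is the unit not gained early. *)
Lemma hard_loss (f : strategy) : (c <= d)%N ->
  (forall s, is_matching (output f (hard s))) ->
  exists2 W : 'I_d -> {set 'I_d}, (forall j, #|W j| = c) &
    forall s, (#|output f (hard s)|
               + \sum_k (#|[set j | (s j + k)%R \in W j]| - c) <= d * d)%N.
Proof.
(* [s0] is an arbitrary reference shift; the set [U] of servers matched early is the same for every
   [s]. *)
move=> cd Mm; pose s0 : {ffun 'I_d -> 'I_d} := [ffun=> ord0].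
pose ans (r : 'I_(d * d)) : option 'I_(d * d) := f (d * d)%N (revealed (G := hard s0) r).
pose U := [set v | [exists r, (hi r < c)%N && (ans r == Some v)]].
pose Ub j := [set x | slot j x \in U].
have ansE s v r : (hi r < c)%N -> ((v, r) \in output f (hard s)) = (ans r == Some v).
  by move=> rc; rewrite inE /= (revealed_hard s s0 rc).
(* Early on, block [j] is served only by its own requests, one per round; the default [slot j j] is
   arbitrary. *)
have cardUb j : (#|Ub j| <= c)%N.
  rewrite -(card_ord_ltn cd); pose g q := lo (odflt (slot j j) (ans (slot q j))).
  apply: leq_trans (leq_imset_card g _); apply: subset_leq_card.
  apply/fintype.subsetP => x; rewrite !inE => /existsP[r /andP[rc ax]].
  have := matching_edge (Mm s0) (etrans (ansE s0 _ _ rc) ax).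
  rewrite /= rc hi_slot => /eqP ej.
  apply/imsetP; exists (hi r); first by rewrite inE.
  by rewrite /g ej slot_hi_lo (eqP ax) /= lo_slot.
have exW j : exists B : {set 'I_d}, Ub j \subset B /\ #|B| = c.
  have [|B ? ?] := @subset_of_card _ (Ub j) c; last by exists B.
  by rewrite cardUb card_ord.
have [W HW] := fin_all_exists exW; exists W => [j|s]; first by case: (HW j).
pose M := output f (hard s).
pose M1 := [set p in M | (hi p.2 < c)%N].
pose M2 k := [set p in M | ~~ (hi p.2 < c)%N & lo p.2 == k].
pose D k := [set j | (s j + k)%R \in W j :\: Ub j].
have cardM : #|M| = (#|M1| + \sum_k #|M2 k|)%N.
  rewrite -sum1_card (bigID (fun p : server (hard s) * request (hard s) => (hi p.2 < c)%N)) /=.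
  congr (_ + _)%N; first by rewrite sum1dep_card.
  rewrite (partition_big (fun p : server (hard s) * request (hard s) => lo p.2) predT) //=.
  apply: eq_bigr => k _; rewrite sum1dep_card; congr #|pred_of_set _|.
  by apply/setP => p; rewrite !inE andbA.
have cardM1 : (#|M1| <= \sum_j #|Ub j|)%N.
  have inj : {in M1 &, injective fst}.
    by move=> p q /setIdP[pM _] /setIdP[qM _]; apply: (matching_inj1 (Mm s)).
  rewrite -(card_in_imset inj) (@leq_trans #|U|) //.
    apply/subset_leq_card/fintype.subsetP => v /imsetP[[w r] /setIdP[wM rc] ->] /=.
    by rewrite inE; apply/existsP; exists r; rewrite -(ansE s) // wM andbT.
  rewrite -sum1_card (partition_big hi predT) //=; apply: leq_sum => j _.
  have slot_inj : injective (slot j) by move=> x y /(congr1 lo); rewrite !lo_slot.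
  rewrite sum1dep_card -(card_imset _ slot_inj).
  apply/subset_leq_card/fintype.subsetP => v; rewrite inE => /andP[vU /eqP <-].
  apply/imsetP; exists (lo v); last by rewrite slot_hi_lo.
  by rewrite inE slot_hi_lo.
(* Group [k] has [d - c] late requests ([le1]), and these can only take servers left free early
   ([le2]). The first bound settles the case of at most [c] hits, the second the other case. *)
have cardM2 k : (#|M2 k| + (#|[set j | (s j + k)%R \in W j]| - c) <= (d - c) + #|D k|)%N.
  have le1 : (#|M2 k| <= d - c)%N.
    rewrite -(card_ord_geq cd) -(@card_in_imset _ _ (fun p => hi p.2) (M2 k)).
      apply/subset_leq_card/fintype.subsetP => q /imsetP[p + ->].
      by rewrite !inE => /and3P[].
    move=> p q /[!inE] /and3P[pM _ /eqP pk] /and3P[qM _ /eqP qk] pq.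
    by apply: (matching_inj2 (Mm s)); rewrite ?inE //; apply: hi_lo_inj; rewrite ?pk.
  have le2 : (#|M2 k| <= #|[set j | (s j + k)%R \notin Ub j]|)%N.
    have M2P p : p \in M2 k ->
        [/\ p \in M, (hi p.2 < c)%N = false & lo p.1 = s (hi p.1) + k].
      case: p => v r /setIdP[pM /andP[/negbTE rc /eqP <-]]; split => //.
      by have := matching_edge (Mm s) pM; rewrite /= rc => /eqP.
    rewrite -(@card_in_imset _ _ (fun p => hi p.1) (M2 k)).
      apply/subset_leq_card/fintype.subsetP => q /imsetP[p /M2P[pM pc pk] ->].
      rewrite !inE -pk slot_hi_lo; apply/existsP => -[r /andP[rc]].
      rewrite -(ansE s) // => rM.
      by move: pc; rewrite (matching_inj1 (Mm s) pM rM erefl) /= rc.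
    move=> p q /M2P[pM _ pk] /M2P[qM _ qk] pq.
    by apply: (matching_inj1 (Mm s)) => //; apply: hi_lo_inj; rewrite ?pk ?qk ?pq.
  pose N := [set j | (s j + k)%R \in W j].
  have : (#|[set j | (s j + k)%R \notin Ub j]| <= #|~: N| + #|D k|)%N.
    rewrite (leq_trans _ (leq_card_setU _ _)) //.
    apply/subset_leq_card/fintype.subsetP => j; rewrite !inE => ->.
    by case: (_ \in W j).
  have := cardsC N; rewrite card_ord -/N; move: le1 le2; lia.
(* As [k] varies, [s j + k] runs once through block [j], so the total late credit equals the early
   deficit. *)
have sumD : (\sum_k #|D k| = \sum_j (c - #|Ub j|))%N.
  under eq_bigr => k _ do rewrite -sum1dep_card big_mkcond.
  rewrite exchange_big /=; apply: eq_bigr => j _.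
  rewrite -big_mkcond sum1dep_card -(proj2 (HW j)) -cardsDS ?(proj1 (HW j)) //.
  by rewrite -[RHS](card_preimset _ (addrI (s j))); apply: eq_card => k; rewrite !inE.
have : (\sum_k (#|M2 k| + (#|[set j | (s j + k)%R \in W j]| - c))
        <= \sum_k ((d - c) + #|D k|))%N by apply: leq_sum => k _.
rewrite !big_split /= sum_nat_const card_ord sumD.
have : (\sum_j #|Ub j| + \sum_j (c - #|Ub j|) = d * c)%N.
  rewrite -big_split /= -[X in (X * c)%N](card_ord d) -sum_nat_const.
  by apply: eq_bigr => j _; rewrite subnKC.
have : (d * c + d * (d - c) = d * d)%N by rewrite -mulnDr subnKC.
move=> e1 e2 H; rewrite -/M cardM -addnA (leq_trans (leq_add cardM1 H)) //.
by rewrite addnCA e2 addnC e1.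
Qed.

Lemma sum_hard_output (f : strategy) : (c <= d)%N ->
  (forall s, is_matching (output f (hard s))) ->
  (\sum_s #|output f (hard s)|
   + d * \sum_(i < d.+1) (i - c) * ('C(d, i) * (c ^ i * (d - c) ^ (d - i)))
   <= d ^ d * (d * d))%N.
Proof.
move=> cd /(hard_loss cd)[W cW lossW].
have -> : (d ^ d * (d * d) = \sum_(s : {ffun 'I_d -> 'I_d}) d * d)%N.
  by rewrite sum_nat_const card_ffun !card_ord.
apply: leq_trans (_ : \sum_s (#|output f (hard s)|
    + \sum_k (#|[set j | (s j + k)%R \in W j]| - c)) <= _)%N; last first.
  by apply: leq_sum => s _; apply: lossW.
rewrite big_split leq_add2l exchange_big /=.
rewrite -[X in (X * _)%N](card_ord d) -sum_nat_const; apply: leq_sum => k _.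
(* Translates of [W j] still have [c] elements, so every group has the same binomial law of hits. *)
pose Wk j := (fun x => x + k) @^-1: W j.
have cWk j : #|Wk j| = c by rewrite card_preimset ?cW //; apply: addIr.
have := sum_ffun_hits (fun i => i - c)%N cWk; rewrite !card_ord => <-.
apply: leq_sum => s _; rewrite leq_sub2r // subset_leq_card //.
by apply/fintype.subsetP => j; rewrite !inE.
Qed.

End HardInstance.

(** * From the average over shifts to randomized algorithms *)

Lemma eta_hard (R : realType) (n : nat) (d := n.+1) (c := uphalf d) :
  eta R d = 1 - (d * \sum_(i < d.+1)
     (i - c) * ('C(d, i) * (c ^ i * (d - c) ^ (d - i))))%:R / (d ^ d * (d * d))%:R.
Proof.
have cd : (c <= d)%N by rewrite /c /d; lia.
have fE : d./2 = (d - c)%N by rewrite /c /d; lia.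
have dn0 : d%:R != 0 :> R by rewrite pnatr_eq0.
rewrite /eta -/c -/d; congr (1 - _).
pose F i := ((i - c) * ('C(d, i) * (c ^ i * (d - c) ^ (d - i))))%N.
(* Truncated subtraction kills the terms with [i <= c]. *)
have -> : (\sum_(i < d.+1) F i = \sum_(c.+1 <= i < d.+1) F i)%N.
  rewrite -(big_mkord predT F) (@big_cat_nat _ _ _ c.+1) //=.
  rewrite big_nat big1 // => i /andP[_]; rewrite ltnS -subn_eq0 /F => /eqP ->.
  by rewrite mul0n.
rewrite natrM natr_sum mulr_sumr mulr_suml; apply: eq_big_nat => i /andP[_ id].
have -> : 1 - d./2%:R / d%:R = c%:R / d%:R :> R.
  by rewrite fE natrB // mulrBl divff // subKr.
have eD : d%:R ^+ d = d%:R ^+ (d - i) * d%:R ^+ i :> R by rewrite -exprD subnK.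
rewrite fE !expr_div_n /F !natrM !natrX eD.
field.
by rewrite !expf_neq0 ?andbT.
Qed.

(** The averaging half of Yao's principle: a bound valid for each fixed seed integrates against [P].
    [ALG] is measurable as a finite sum of indicators of events on the answers. *)
Lemma expectation_ALG_sum (R : realType) (d : nat)
    (disp : measure_display) (T : measurableType disp) (P : probability T R)
    (A : T -> strategy) (hA : online_algorithm d A) (I : finType)
    (G : I -> instance) (b : R) :
  (forall w, \sum_i ALG A (G i) w <= b) ->
  (\sum_i 'E_P[ALG A (G i)] <= b%:E)%E.
Proof.
move=> hb; have mG i : measurable_fun [set: T]%classic (ALG A (G i) : T -> R).
  rewrite /ALG.
  rewrite (_ : (fun _ => _) = fun w =>
      \sum_(p : server (G i) * request (G i))
        \1_([set w | A w _ (revealed p.2) = Some p.1]%classic) w); last first.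
    apply/funext => w; rewrite -sum1_card natr_sum big_mkcond /=.
    apply: eq_bigr => p _; rewrite inE indicE.
    rewrite (_ : (w \in _) = (A w _ (revealed p.2) == Some p.1)); first by case: eqP.
    by apply/idP/eqP => [/set_mem|e]; last exact: mem_set.
  apply: measurable_sum => p; apply: measurable_indic; apply: (proj1 hA).
under eq_bigr do rewrite unlock; rewrite -ge0_integral_sum //=; last 2 first.
- by move=> i; apply/measurable_EFinP; apply: mG.
- by move=> i w _; rewrite lee_fin.
apply: (@le_trans _ _ (\int[P]_x (cst b%:E x))%E).
  apply: ge0_le_integral => //.
  - by move=> w _; rewrite sume_ge0 // => i _; rewrite lee_fin.
  - by apply: emeasurable_sum => i; apply/measurable_EFinP; apply: mG.
  - by move=> w _; rewrite sumEFin lee_fin.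
by rewrite integral_cst //= probability_setT mule1.
Qed.

Theorem theoremD1 (R : realType) (d : nat) (hd : (2 <= d)%N)
    (disp : measure_display) (T : measurableType disp) (P : probability T R)
    (A : T -> strategy) (hA : online_algorithm d A) :
  (competitive_ratio P d A <= (eta R d)%:E)%E.
Proof.
case: d hd hA => // n _ hA.
(* Passing to real lower bounds [x] avoids infinite values: a ratio [+oo] is refuted by
   [x = eta + 1]. *)
suff H x : (x%:E <= competitive_ratio P n.+1 A)%E -> x <= eta R n.+1.
  case: competitive_ratio H => [r H|H|_]; [| |exact: leNye].
    by rewrite lee_fin H.
  by have := H (eta R n.+1 + 1) (leey _); rewrite gerDl ler10.
move=> xle; pose c := uphalf n.+1; have cd : (c <= n.+1)%N by rewrite /c; lia.
have dd0 : 0 < (n.+1 * n.+1)%:R :> R by rewrite ltr0n.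
have dd0' : 0 < (n.+1 ^ n.+1 * (n.+1 * n.+1))%:R :> R.
  by rewrite ltr0n muln_gt0 expn_gt0.
have xE (s : {ffun 'I_n.+1 -> 'I_n.+1}) : ((x * (n.+1 * n.+1)%:R)%:E <= 'E_P[ALG A (hard c s)])%E.
  rewrite EFinM -lee_pdivlMr //.
  apply: le_trans xle _; apply: ereal_inf_lbound; exists (hard c s) => /=.
    by split; [exact: hard_regular | rewrite OPT_hard].
  by rewrite OPT_hard inver gt_eqF.
(* Summing over all shifts, rather than choosing a worst one, allows the exchange with the
   expectation. *)
have : ((\sum_(s : {ffun 'I_n.+1 -> 'I_n.+1}) (x * (n.+1 * n.+1)%:R)%:E)
    <= (eta R n.+1 * (n.+1 ^ n.+1 * (n.+1 * n.+1))%:R)%:E)%E; last first.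
  rewrite sumEFin lee_fin sumr_const card_ffun !card_ord -[leLHS]mulr_natr -mulrA.
  by rewrite -natrM mulnC ler_pM2r.
apply: le_trans (lee_sum _ (fun s _ => xE s)) _.
apply: (expectation_ALG_sum P hA) => w.
rewrite eta_hard -/c mulrBl mul1r divfK ?gt_eqF // lerBrDr -natr_sum -natrD ler_nat.
apply: sum_hard_output => // s; apply: (proj2 hA); exact: hard_regular.
Qed.
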